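(* Let $X \subseteq \mathbb{R}^n$ be nonempty and closed, let $f \colon \mathbb{R}^n \to \mathbb{R}$ be continuously differentiable, let $\rho > 0$, and let $p^\rho(y) = \sum_{i=1}^n p_i^\rho(y_i)$, where each $p_i^\rho \colon \mathbb{R} \to \mathbb{R}$ satisfies (P.1)--(P.3) stated in the context. Consider the problems (SPO): $\min_x f(x) + \rho \|x\|_0$ subject to $x \in X$, (SPOref): $\min_{x,y} f(x) + p^\rho(y)$ subject to $x \in X$, $x \circ y = 0$. A point $x^* \in X$ is a local minimum of (SPO) if and only if $(x^*, y^* )$ is a local minimum of (SPOref), where $y^* \in \mathbb{R}^n$ is given by $y_i^* = s_i^\rho$ for $i \in I_0(x^* )$ and $y_i^* = 0$ otherwise.
   Context: Notation: $\|x\|_0$ is the number of nonzero components of $x \in \mathbb{R}^n$; $I_0(x) := \{ i \mid x_i = 0 \}$; $x \circ y$ is the componentwise (Hadamard) product. Conditions on the functions $p_i^\rho \colon \mathbb{R} \to \mathbb{R}$, $i = 1,\dots,n$: (P.1) $p_i^\rho$ is convex and attains a unique minimum (possibly depending on $\rho$) at some point $s_i^\rho > 0$; (P.2) $p_i^\rho(0) - p_i^\rho(s_i^\rho) = \rho$; (P.3) $p_i^\rho$ is sufficiently smooth; here only continuity is required. *)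

(* Defs.v *)
From HB Require Import structures.
From mathcomp Require Import all_boot all_order all_algebra.
From mathcomp Require Import all_classical all_reals all_analysis.

Set Implicit Arguments.
Unset Strict Implicit.
Unset Printing Implicit Defensive.

Import Order.TTheory GRing.Theory Num.Theory.
Import numFieldNormedType.Exports.

Local Open Scope classical_set_scope.
Local Open Scope ring_scope.

Definition gradient (R : realType) (n : nat) (f : 'rV[R]_n -> R)
    (x : 'rV[R]_n) : 'rV[R]_n :=
  \row_i 'd f x (delta_mx ord0 i).

Definition continuously_differentiable (R : realType) (n : nat)
    (f : 'rV[R]_n -> R) : Prop :=
  (forall x, differentiable f x) /\ continuous (gradient f).

Definition local_min (R : realType) (T : topologicalType)
    (F : T -> R) (A : set T) (a : T) : Prop :=
  A a /\ \forall z \near a, A z -> F a <= F z.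

Definition unique_minimizer (R : realType) (g : R -> R) (s : R) : Prop :=
  (forall t, g s <= g t) /\ (forall u, (forall t, g u <= g t) -> u = s).

Definition norm0 (R : realType) (n : nat) (x : 'rV[R]_n) : nat :=
  #|[pred i | x ord0 i != 0]|.

Definition I0 (R : realType) (n : nat) (x : 'rV[R]_n) : {set 'I_n} :=
  [set i | x ord0 i == 0]%SET.

Definition hadamard (R : realType) (n : nat) (x y : 'rV[R]_n) : 'rV[R]_n :=
  \row_i (x ord0 i * y ord0 i).

(* The parameter rho is fixed, so g may depend on it; s is determined by g. *)
Record penalty_conditions (R : realType) (rho : R) (g : R -> R) (s : R)
    : Prop := PenaltyConditions {
  penalty_convex : convex_function [set: R^o] g ;
  penalty_min : unique_minimizer g s ;
  penalty_min_gt0 : 0 < s ;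
  penalty_gap : g 0 - g s = rho ;
  penalty_continuous : continuous g }.

Definition penalty (R : realType) (n : nat) (p : 'I_n -> R -> R)
    (y : 'rV[R]_n) : R :=
  \sum_(i < n) p i (y ord0 i).

Definition SPO_objective (R : realType) (n : nat) (f : 'rV[R]_n -> R)
    (rho : R) (x : 'rV[R]_n) : R :=
  f x + rho * (norm0 x)%:R.

Definition SPOref_objective (R : realType) (n : nat) (f : 'rV[R]_n -> R)
    (p : 'I_n -> R -> R) (z : 'rV[R]_n * 'rV[R]_n) : R :=
  f z.1 + penalty p z.2.

Definition SPOref_feasible (R : realType) (n : nat) (X : set 'rV[R]_n)
    : set ('rV[R]_n * 'rV[R]_n) :=
  [set z | X z.1 /\ hadamard z.1 z.2 = 0].

Definition ystar (R : realType) (n : nat) (s : 'I_n -> R) (x : 'rV[R]_n)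
    : 'rV[R]_n :=
  \row_i (if i \in I0 x then s i else 0).

(* Main.v *)
Require Import Defs.
From HB Require Import structures.
From mathcomp Require Import all_boot all_order all_algebra.
From mathcomp Require Import all_classical all_reals all_analysis.
Import Order.TTheory GRing.Theory Num.Theory.
Import numFieldNormedType.Exports.
Local Open Scope classical_set_scope.
Local Open Scope ring_scope.

(** Why the theorem holds.  Near a point the support of a vector can only grow
    ([near_support]).  This shows that both problems are locally the same
    third one: minimize [f] over the points of [X] that keep every zero of
    [xs].

    For the sparsity problem, a nearby [x] in [X] either keeps all the zeros of
    [xs], and then the term [rho * norm0 x] has the same value as at [xs], or
    it pays at least [rho] more, which the small variation of the continuous
    function [f] cannot compensate
    ([SPO_local_min_zero_preserving]).

    For the reformulation, [ystar s xs] is nonzero exactly on the zeros of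
    [xs].  A nearby [y] stays nonzero there, so complementarity forces a
    feasible nearby [x] to keep the zeros of [xs].  As [x] also keeps the
    support of [xs], complementarity makes [y] vanish on that support, where it
    then agrees with [ystar s xs], while on the other coordinates
    [ystar s xs] minimizes each [p i].  Hence the penalty cannot decrease, and
    only [f] is left to compare ([SPOref_local_min_zero_preserving]). *)

(** Each nonzero coordinate stays nonzero on a neighbourhood, and there are
    only finitely many of them. *)
Lemma near_support (R : realType) (n : nat) (x0 : 'rV[R]_n) :
  \forall x \near x0, I0 x \subset I0 x0.
Proof.
have coordN0 i : \forall x \near x0, x0 ord0 i != 0 -> (x : 'rV[R]_n) ord0 i != 0.
  have [_|x0i_neq0] := eqVneq (x0 ord0 i) 0; first by near=> x.
  have /cvgr_neq0 := @coord_continuous R 1 n ord0 i x0.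
  by move=> /(_ x0i_neq0); apply: filterS.
have := filter_forall (nbhs_filter x0) coordN0.
apply: filterS => x x_supp /=; apply/fintype.subsetP => i; rewrite !inE.
by apply: contraLR; exact: x_supp.
Unshelve. all: by end_near.
Qed.

Lemma norm0E (R : realType) (n : nat) (x : 'rV[R]_n) :
  norm0 x = #|~: I0 x|.
Proof. by apply: eq_card => i; rewrite !inE. Qed.

(** Complementarity as an inclusion of zero sets, so that the rest of the
    argument is a calculation in the lattice of index sets. *)
Lemma hadamard_eq0 (R : realType) (n : nat) (x y : 'rV[R]_n) :
  hadamard x y = 0 <-> ~: I0 y \subset I0 x.
Proof.
split=> [/rowP xy0|/fintype.subsetP yx].
  apply/fintype.subsetP => i; rewrite !inE => /negPf yi0.
  by have /eqP := xy0 i; rewrite !mxE mulf_eq0 yi0 orbF.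
apply/rowP => i; rewrite !mxE.
have [->|yi0] := eqVneq (y ord0 i) 0; first by rewrite mulr0.
by have /eqP-> : x ord0 i == 0; [have := yx i; rewrite !inE; apply|rewrite mul0r].
Qed.

(** Positivity of the minimizers [s i] makes the pair [x], [ystar s x] strictly
    complementary; this is what transfers stability of supports from the
    variable [y] to the zeros of [x]. *)
Lemma I0_ystar (R : realType) (n : nat) (s : 'I_n -> R) (x : 'rV[R]_n) :
  (forall i, 0 < s i) -> I0 (ystar s x) = ~: I0 x.
Proof.
move=> s_gt0; apply/finset.setP => i; rewrite !inE !mxE inE.
by case: ifP => _; rewrite ?eqxx // (gt_eqF (s_gt0 i)).
Qed.

(** Coordinatewise: on the zeros of [x] the entries of [ystar s x] are global
    minimizers, and on the support of [x] both [y] and [ystar s x] vanish. *)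
Lemma penalty_ystar_le (R : realType) (n : nat) (p : 'I_n -> R -> R)
    (s : 'I_n -> R) (x y : 'rV[R]_n) :
  (forall i t, p i (s i) <= p i t) -> ~: I0 x \subset I0 y ->
  penalty p (ystar s x) <= penalty p y.
Proof.
move=> p_min /fintype.subsetP xy; apply: ler_sum => i _; rewrite mxE.
case: ifPn => [_|xi]; first exact: p_min.
by have := xy i; rewrite finset.in_setC xi inE => /(_ isT) /eqP ->.
Qed.

(** Combined with [near_support], these are locally the points with the same
    support as [x0]. *)
Definition zero_preserving {R : realType} {n : nat} (x0 : 'rV[R]_n) :
  set 'rV[R]_n := [set x | I0 x0 \subset I0 x].

(** The counting term is constant on the nearby points that keep the zeros of
    [x0] and jumps by at least [rho] on the others, where the bound
    [f x > f x0 - rho] given by continuity is then enough. *)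
Lemma SPO_local_min_zero_preserving (R : realType) (n : nat)
    (X : set 'rV[R]_n) (f : 'rV[R]_n -> R) (rho : R) (x0 : 'rV[R]_n) :
  0 < rho -> {for x0, continuous f} ->
  local_min (SPO_objective f rho) X x0 <->
  local_min f (X `&` zero_preserving x0) x0.
Proof.
move=> rho_gt0 f_cont; split=> -[].
  move=> Xx0 min0; split; first by split=> //; exact: fintype.subxx.
  near=> x; move=> [Xx x0x].
  have I0E : I0 x = I0 x0.
    by apply/eqP; rewrite finset.eqEsubset x0x andbT; near: x; exact: near_support.
  have : SPO_objective f rho x0 <= SPO_objective f rho x.
    by move: (Xx); near: x.
  by rewrite /SPO_objective !norm0E I0E lerD2r.
move=> [Xx0 _] min0; split=> //.
near=> x; move=> Xx; rewrite /SPO_objective !norm0E.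
have xx0 : I0 x \subset I0 x0 by near: x; exact: near_support.
have [x0x|x0Nx] := boolP (I0 x0 \subset I0 x).
  have -> : I0 x = I0 x0 by apply/eqP; rewrite finset.eqEsubset xx0 x0x.
  by rewrite lerD2r; have : (X `&` zero_preserving x0) x by []; near: x.
have supp_lt : (#|~: I0 x0| < #|~: I0 x|)%N.
  by apply: proper_card; rewrite finset.properC properE xx0.
have fx : f x0 - rho < f x.
  near: x; apply: (cvgr_gt (f x0)); first exact: f_cont.
  by rewrite ltrBlDr ltrDl.
have : rho * (#|~: I0 x0|.+1)%:R <= rho * (#|~: I0 x|)%:R.
  by rewrite ler_pM2l // ler_nat.
rewrite -natr1 mulrDr mulr1 => supp_gap.
apply: le_trans (lerD (ltW fx) supp_gap).
by rewrite addrACA addNr addr0.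
Unshelve. all: by end_near.
Qed.

(** One direction restricts the reformulated problem to the slice where [y] is
    fixed at [ystar s x0]: its feasible points are exactly the points of [X]
    that keep the zeros of [x0].  For the other one, strict complementarity
    sandwiches the zero sets of any feasible pair near [(x0, ystar s x0)]. *)
Lemma SPOref_local_min_zero_preserving (R : realType) (n : nat)
    (X : set 'rV[R]_n) (f : 'rV[R]_n -> R) (p : 'I_n -> R -> R)
    (s : 'I_n -> R) (x0 : 'rV[R]_n) :
  (forall i, 0 < s i) -> (forall i t, p i (s i) <= p i t) ->
  local_min (SPOref_objective f p) (SPOref_feasible X) (x0, ystar s x0) <->
  local_min f (X `&` zero_preserving x0) x0.
Proof.
move=> s_gt0 p_min.
have feas x : SPOref_feasible X (x, ystar s x0) <-> (X `&` zero_preserving x0) x.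
  rewrite /SPOref_feasible /zero_preserving /=.
  by rewrite hadamard_eq0 I0_ystar // finset.setCK.
split=> -[].
  move=> /feas X0 min0; split=> //.
  (* The embedding of the slice is continuous, so neighbourhoods pull back. *)
  have emb : (fun x => (x, ystar s x0)) @ x0 --> (x0, ystar s x0).
    by apply: (cvg_pair (F := nbhs x0) (G := nbhs x0) (H := nbhs (ystar s x0)));
      [exact: cvg_id|exact: cvg_cst].
  near=> x; move=> /feas feas_x.
  have : SPOref_objective f p (x0, ystar s x0) <=
         SPOref_objective f p (x, ystar s x0).
    by move: feas_x; near: x; exact: (emb _ min0).
  by rewrite /SPOref_objective /= lerD2r.
move=> X0 min0; split; first exact/feas.
near=> z; move=> [Xz /hadamard_eq0 zy].
have zx : I0 z.1 \subset I0 x0.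
  near: z; exact: (cvg_fst (near_support _ _ x0)).
have yz : I0 z.2 \subset ~: I0 x0.
  rewrite -(I0_ystar _ _ s) //.
  near: z; exact: (cvg_snd (near_support _ _ (ystar s x0))).
(* [y] is nonzero wherever [x0] vanishes, so [x] must vanish there. *)
have x0z : I0 x0 \subset I0 z.1.
  by apply: fintype.subset_trans zy; rewrite finset.subsetC.
rewrite /SPOref_objective /=; apply: lerD.
  have : (X `&` zero_preserving x0) z.1 by [].
  near: z; exact: (cvg_fst min0).
apply: penalty_ystar_le => //.
by rewrite finset.subCset (fintype.subset_trans _ zx) // -finset.subCset.
Unshelve. all: by end_near.
Qed.

Theorem theorem3p3 (R : realType) (n : nat) (X : set 'rV[R]_n)
    (f : 'rV[R]_n -> R) (rho : R) (p : 'I_n -> R -> R) (s : 'I_n -> R)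
    (X_nonempty : X !=set0) (X_closed : closed X)
    (f_C1 : continuously_differentiable f)
    (rho_gt0 : 0 < rho)
    (p_cond : forall i : 'I_n, penalty_conditions rho (p i) (s i))
    (xs : 'rV[R]_n) (xs_in_X : X xs) :
  local_min (SPO_objective f rho) X xs <->
  local_min (SPOref_objective f p) (SPOref_feasible X) (xs, ystar s xs).
Proof.
have f_cont : {for xs, continuous f}.
  exact/differentiable_continuous/(f_C1.1 xs).
rewrite (SPOref_local_min_zero_preserving _ _ X f p s xs).
- exact: SPO_local_min_zero_preserving.
- by move=> i; exact: penalty_min_gt0 (p_cond i).
- by move=> i; have [] := penalty_min (p_cond i).
Qed.
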